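(* Let $a,b$ be integers with $1 \leq a \leq b$ and $b \neq 1$, and let $G = C_{2a} \square C_{2b}$ be the Cartesian product of the cycles $C_{2a}$ and $C_{2b}$. Then for every $2$-coloring of $E(G)$ there are vertices $u,v \in V(G)$ whose distance in $G$ is $a+b$ and a path in $G$ between $u$ and $v$ which changes its color at most $b-1$ times.
   Context: $C_2$ denotes the complete graph on two vertices (a single edge); for $m \geq 2$, $C_{2m}$ is the cycle of length $2m$. The Cartesian product $H_1 \square H_2$ has vertex set $V(H_1)\times V(H_2)$, with $(x,y)$ adjacent to $(x',y')$ iff either $x=x'$ and $yy' \in E(H_2)$, or $y=y'$ and $xx' \in E(H_1)$. A $2$-coloring of $E(G)$ is a function from $E(G)$ to $\{\text{red},\text{blue}\}$. A path changes its color $t$ times if exactly $t$ pairs of consecutive edges on it receive different colors. *)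

(* Defs.v *)
From mathcomp Require Import all_boot.

Set Implicit Arguments.
Unset Strict Implicit.
Unset Printing Implicit Defensive.

(* A finite simple graph is a symmetric irreflexive relation on a finType.    *)

(* The cycle of length n on {0, ..., n-1}.  For n = 2 the two disjuncts       *)
(* coincide and the graph is a single edge, i.e., the complete graph on two   *)
(* vertices.                                                                  *)
Definition cycle_rel (n : nat) : rel 'I_n :=
  fun i j => (i.+1 %% n == j) || (j.+1 %% n == i).

Definition cartesian_rel (T1 T2 : eqType) (e1 : rel T1) (e2 : rel T2) :
    rel (T1 * T2) :=
  fun x y => ((x.1 == y.1) && e2 x.2 y.2) || ((x.2 == y.2) && e1 x.1 y.1).

(* The vertex sequence of the path is x :: p, so its length is size p.        *)
Definition is_path (T : eqType) (e : rel T) (x y : T) (p : seq T) : Prop :=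
  [/\ path e x p, last x p = y & uniq (x :: p)].

Definition is_dist (T : eqType) (e : rel T) (x y : T) (d : nat) : Prop :=
  (exists2 p, is_path e x y p & size p = d) /\
  (forall p, is_path e x y p -> d <= size p).

(* An edge is the set of its two endpoints.  Colorings are total functions on *)
(* {set T}, the two colors being the booleans; only the values at edges of    *)
(* the graph are ever used.                                                   *)
Definition edge_colors (T : finType) (c : {set T} -> bool) (x : T) (p : seq T) :
    seq bool :=
  pairmap (fun y z => c [set y; z]) x p.

Definition num_changes (s : seq bool) : nat :=
  if s is c0 :: s' then count id (pairmap (fun c1 c2 => c1 != c2) c0 s') else 0.

Lemma cycle_rel_sym (n : nat) : symmetric (@cycle_rel n).
Proof. by move=> i j; rewrite /cycle_rel orbC. Qed.

Lemma cycle_rel_irrefl (n : nat) : n != 1 -> irreflexive (@cycle_rel n).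
Proof.
move=> n1 i; rewrite /cycle_rel orbb; apply/negbTE/eqP.
have := ltn_ord i; rewrite leq_eqVlt => /orP[/eqP E|lt_in].
  by rewrite E modnn => i0; rewrite -E -i0 in n1.
by rewrite modn_small // => /esym/n_Sn.
Qed.

Lemma cartesian_rel_sym (T1 T2 : eqType) (e1 : rel T1) (e2 : rel T2) :
  symmetric e1 -> symmetric e2 -> symmetric (cartesian_rel e1 e2).
Proof.
move=> s1 s2 x y; rewrite /cartesian_rel s1 s2.
by rewrite [x.1 == _]eq_sym [x.2 == _]eq_sym.
Qed.

Lemma cartesian_rel_irrefl (T1 T2 : eqType) (e1 : rel T1) (e2 : rel T2) :
  irreflexive e1 -> irreflexive e2 -> irreflexive (cartesian_rel e1 e2).
Proof. by move=> i1 i2 x; rewrite /cartesian_rel i1 i2 !andbF. Qed.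

(* Main.v *)
Require Import Defs.
From mathcomp Require Import all_boot.
From mathcomp Require Import all_algebra zify.

(* Cross a unit square diagonally, from lower left to upper right, by one of  *)
(* its two routes, with edge colors (e1, o1) and (e2, o2).  Whatever the color*)
(* of the edge used before, the better route costs at most W changes, counted *)
(* up to its last edge, where W = 2 if e1 = e2 <> o1 = o2, W = 0 if           *)
(* e1 = o1 <> e2 = o2, and W = 1 otherwise.  Crossing the same square from    *)
(* lower right to upper left exchanges o1 and e2, so the two weights sum to 2.*)
(* Hence the walks made of a diagonal crossings and b - a further steps, over *)
(* all starting points and both directions, cost b on average, or less since  *)
(* the first square may be entered for free.  The average is below b, and     *)
(* some walk costs at most b - 1, unless the free entry never helps; then     *)
(* every square is alternately colored, so that all the edges of one factor   *)
(* are red and all those of the other are blue, and one change suffices.      *)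

Set Implicit Arguments.
Unset Strict Implicit.
Unset Printing Implicit Defensive.

Import GRing.Theory.

(** The vertices of each cycle are treated as residues. A walk with [a] steps in one fixed
    horizontal direction and [b] steps up, in any order, ends at the antipode and is a geodesic
    ([geodesic_walk]), so the coloring may dictate the order. [start_walk] picks it square by
    square, [face_weightN] gives the average, [start_cost_or_alternating] the dichotomy, and
    [alternating_colors] settles the exceptional coloring. *)

Section CycleDistance.

Local Open Scope ring_scope.

Lemma val_Zp_succ (m : nat) (i : 'I_m.+2) :
  (i + 1 : 'I_m.+2) = (i.+1 %% m.+2)%N :> nat.
Proof. by rewrite /= modnDmr addn1. Qed.

Lemma cycle_relE (m : nat) (i j : 'I_m.+2) :
  cycle_rel i j = (j == i + 1) || (i == j + 1).
Proof.
by rewrite /cycle_rel -!val_Zp_succ !val_eqE [_ == j]eq_sym [_ == i]eq_sym.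
Qed.

(** The shorter of the two arcs between [0] and [i]. *)
Definition cycle_norm (m : nat) (i : 'I_m.+2) : nat := minn i (m.+2 - i).

Lemma cycle_norm_succ (m : nat) (i : 'I_m.+2) :
  (cycle_norm (i + 1)%R <= (cycle_norm i).+1)%N /\
  (cycle_norm i <= (cycle_norm (i + 1)%R).+1)%N.
Proof.
rewrite /cycle_norm val_Zp_succ.
have := ltn_ord i; rewrite leq_eqVlt => /orP[/eqP E|lt_im].
  by rewrite E modnn; lia.
by rewrite modn_small //; lia.
Qed.

Lemma cycle_norm_adj (m : nat) (k i j : 'I_m.+2) :
  cycle_rel i j -> (cycle_norm (j - k)%R <= (cycle_norm (i - k)%R).+1)%N.
Proof.
rewrite cycle_relE => /orP[] /eqP->; rewrite addrAC.
  by case: (cycle_norm_succ (i - k)).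
by case: (cycle_norm_succ (j - k)).
Qed.

Lemma cycle_norm0 (m : nat) : cycle_norm (0 : 'I_m.+2) = 0%N.
Proof. by rewrite /cycle_norm min0n. Qed.

Lemma cycle_norm_half (m a : nat) (d : 'I_m.+2) :
  m.+2 = (2 * a)%N -> d = 1 \/ d = -1 -> cycle_norm (d *+ a) = a.
Proof.
move=> mE dE.
have aE : (1 *+ a : 'I_m.+2) = a :> nat by rewrite Zp_nat /= modn_small; lia.
rewrite /cycle_norm; case: dE => ->; first by rewrite aE; lia.
by rewrite mulNrn /= aE modn_small; lia.
Qed.

End CycleDistance.

(** * Monotone walks between antipodes, and their color changes *)

Section Torus.

Local Open Scope ring_scope.

Variables m n : nat.
Local Notation V := ('I_m.+2 * 'I_n.+2)%type.
Local Notation G := (cartesian_rel (@cycle_rel m.+2) (@cycle_rel n.+2)).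

Definition torus_norm (u : V) : nat := cycle_norm u.1 + cycle_norm u.2.

(** An edge moves one coordinate by one, so the norm grows by at most 1 per step; this bounds
    distances from below. *)
Lemma torus_norm_path (u v : V) (p : seq V) :
  path G v p ->
  (torus_norm (last v p - u)%R <= torus_norm (v - u)%R + size p)%N.
Proof.
elim: p v => [|w p IH] v /=; first by rewrite addn0.
case/andP=> vw /IH le_w; apply: leq_trans le_w _.
rewrite addnS -addSn leq_add2r.
case/orP: vw => /andP[/eqP E adj]; rewrite /torus_norm /= -E.
  by rewrite -addnS leq_add2l; apply: cycle_norm_adj.
by rewrite -addSn leq_add2r; apply: cycle_norm_adj.
Qed.

Definition torus_step (d : 'I_m.+2) (t : bool) (u : V) : V :=
  if t then (u.1 + d, u.2) else (u.1, u.2 + 1).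

Fixpoint walk (d : 'I_m.+2) (u : V) (s : seq bool) : seq V :=
  if s is t :: s' then torus_step d t u :: walk d (torus_step d t u) s'
  else [::].

Lemma size_walk d u s : size (walk d u s) = size s.
Proof. by elim: s u => //= t s IH u; rewrite IH. Qed.

Lemma last_walk d u s :
  last u (walk d u s) = u + (d *+ count id s, 1 *+ count negb s).
Proof.
elim: s u => [|t s IH] u /=; first by rewrite !mulr0n addr0.
by rewrite IH; case: t u => -[x y]; congr (_, _);
  rewrite /= ?add0n // add1n mulrS addrA.
Qed.

Lemma path_walk d u s : d = 1 \/ d = -1 -> path G u (walk d u s).
Proof.
move=> dE; elim: s u => //= t s IH u; rewrite IH andbT /cartesian_rel.
case: t => /=; rewrite !eqxx !cycle_relE /= ?eqxx //.
by apply/orP; right; case: dE => ->; rewrite ?addrNK eqxx ?orbT.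
Qed.

Variables a b : nat.
Hypotheses (mE : m.+2 = (2 * a)%N) (nE : n.+2 = (2 * b)%N).

Lemma geodesic_walk d u s :
  d = 1 \/ d = -1 -> count id s = a -> count negb s = b ->
  let v := u + (d *+ a, 1 *+ b) in
  is_dist G u v (a + b) /\ is_path G u v (walk d u s).
Proof.
move=> dE sa sb v.
have sz : size (walk d u s) = (a + b)%N.
  by rewrite size_walk -sa -sb -(count_predC id).
have lb p : path G u p -> last u p = v -> (a + b <= size p)%N.
  move=> /(torus_norm_path u) + lp; rewrite lp subrr addrC addKr.
  rewrite /torus_norm /= !cycle_norm0 !cycle_norm_half //; by left.
have pw := path_walk u s dE.
have lw : last u (walk d u s) = v by rewrite last_walk sa sb.
(* A duplicate-free shortening has the same ends, so by [lb] it is no shorter; hence the walk has no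
   repetition. *)
have uw : uniq (u :: walk d u s).
  case: (shortenP pw) lw => p' pp' up' sub lp'.
  apply: (leq_size_uniq up'); last by rewrite /= ltnS sz; apply: lb.
  by move=> w; rewrite !inE => /orP[->//|/sub->]; rewrite orbT.
have iw : is_path G u v (walk d u s) by split.
split=> //; split; first by exists (walk d u s).
by move=> p [pp lp _]; apply: lb.
Qed.

Local Close Scope ring_scope.
Local Open Scope nat_scope.

Local Notation east := (1%R : 'I_m.+2).
Local Notation west := ((-1)%R : 'I_m.+2).

Implicit Types (d : 'I_m.+2) (u v w : V) (s : seq bool).

Variable c : {set V} -> bool.

Local Notation colors d u s := (edge_colors c u (walk d u s)).

(** Here [x] is the color of the edge used just before. *)
Definition changes_from (x : bool) (s : seq bool) : nat :=
  count id (pairmap (fun y z => y != z) x s).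

Definition xcolor d u := c [set u; torus_step d true u].
Definition ycolor d u := c [set u; torus_step d false u].

Definition route_weight (e1 o1 e2 o2 : bool) : nat :=
  if [&& e1 == e2, o1 == o2 & e1 != o1] then 2
  else if [&& e1 == o1, e2 == o2 & e1 != e2] then 0 else 1.

Definition face_weight d u : nat :=
  route_weight (xcolor d u) (ycolor d (torus_step d true u))
               (ycolor d u) (xcolor d (torus_step d false u)).

(** The cost of the cheaper route across the first square, which no earlier edge precedes. *)
Definition face_start d u : nat :=
  (xcolor d u != ycolor d (torus_step d true u)) &&
  (ycolor d u != xcolor d (torus_step d false u)).

Lemma diagonal_step d u i :
  (u + (d, 1) *+ i.+1 =
   torus_step d false (torus_step d true u) + (d, 1) *+ i)%R.
Proof. by rewrite mulrS addrA. Qed.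

(** The route across each square is chosen knowing the last color [x], and its final edge supplies
    the next [x]. Each of the [l] remaining steps up costs at most 1. *)
Lemma diagonal_walk d u x (k l : nat) :
  exists2 s, count id s = k /\ count negb s = (k + l)%N &
    changes_from x (colors d u s) <=
    \sum_(i < k) face_weight d (u + (d, 1) *+ i)%R + l.
Proof.
elim: k u x => [|k IH] u x.
  exists (nseq l false); first by rewrite !count_nseq /= mul1n.
  rewrite big_ord0 add0n /changes_from (leq_trans (count_size _ _)) //.
  by rewrite /edge_colors !size_pairmap size_walk size_nseq.
rewrite big_ord_recl mulr0n addr0 -addnA.
under eq_bigr => i _ do rewrite lift0 diagonal_step.
have [le|le] : (x != xcolor d u) +
     (xcolor d u != ycolor d (torus_step d true u)) <= face_weight d u \/
   (x != ycolor d u) +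
     (ycolor d u != xcolor d (torus_step d false u)) <= face_weight d u.
  rewrite /face_weight; move: (xcolor d u) (ycolor d u)
    (xcolor d (torus_step _ _ _)) (ycolor d (torus_step _ _ _)).
  by case: x => -[] [] [] []; (left; done) || right.
- have [s [s1 s2] les] := IH (torus_step d false (torus_step d true u))
    (ycolor d (torus_step d true u)).
  exists [:: true, false & s]; first by rewrite /= s1 s2.
  by rewrite /changes_from /= addnA; apply: leq_add.
- have [s [s1 s2] les] := IH (torus_step d false (torus_step d true u))
    (xcolor d (torus_step d false u)).
  exists [:: false, true & s]; first by rewrite /= s1 s2.
  by rewrite /changes_from /= addnA; apply: leq_add.
Qed.

Lemma start_walk d u (k l : nat) :
  exists2 s, count id s = k.+1 /\ count negb s = (k.+1 + l)%N &
    num_changes (colors d u s) <=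
    face_start d u + \sum_(i < k) face_weight d (u + (d, 1) *+ i.+1)%R + l.
Proof.
under eq_bigr => i _ do rewrite diagonal_step.
rewrite -addnA.
have [le|le] :
    (xcolor d u != ycolor d (torus_step d true u)) <= face_start d u \/
    (ycolor d u != xcolor d (torus_step d false u)) <= face_start d u.
  by rewrite /face_start; case: (_ != _); case: (_ != _); (left; done) || right.
- have [s [s1 s2] les] :=
    diagonal_walk d (torus_step d false (torus_step d true u))
      (ycolor d (torus_step d true u)) k l.
  exists [:: true, false & s]; first by rewrite /= s1 s2.
  exact: leq_add.
- have [s [s1 s2] les] :=
    diagonal_walk d (torus_step d false (torus_step d true u))
      (xcolor d (torus_step d false u)) k l.
  exists [:: false, true & s]; first by rewrite /= s1 s2.
  exact: leq_add.
Qed.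

Lemma torus_stepNK u : torus_step west true (torus_step east true u) = u.
Proof. by case: u => x y; rewrite /torus_step /= addrK. Qed.

Lemma xcolorN u : xcolor west (torus_step east true u) = xcolor east u.
Proof. by rewrite /xcolor torus_stepNK setUC. Qed.

(* The square with lower left corner [u] is crossed eastward from [u] and     *)
(* westward from the lower right corner.                                      *)
Lemma face_weightN u :
  face_weight east u + face_weight west (torus_step east true u) = 2.
Proof.
rewrite /face_weight torus_stepNK.
have -> : torus_step west false (torus_step east true u) =
          torus_step east true (torus_step east false u) by [].
rewrite !xcolorN -![ycolor west _]/(ycolor east _).
by move: (xcolor east u) (ycolor east u)
  (xcolor east (torus_step _ _ _)) (ycolor east (torus_step _ _ _))
      => [] [] [] [].
Qed.

Lemma sum_translate (F : V -> nat) v :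
  \sum_(u : V) F (u + v)%R = \sum_(u : V) F u.
Proof. by rewrite [RHS](reindex_inj (addIr v)). Qed.

Lemma torus_step1E u : torus_step east true u = (u + (1, 0))%R.
Proof.
by case: u => x y; rewrite /torus_step /=; congr (_, _); rewrite /= addr0.
Qed.

Lemma sum_face_weight :
  \sum_(u : V) face_weight east u + \sum_(u : V) face_weight west u =
  #|{: V}| * 2.
Proof.
rewrite -(sum_translate (face_weight west) (1, 0)%R) -big_split /=.
rewrite -sum_nat_const; apply: eq_bigr => u _.
by rewrite -torus_step1E face_weightN.
Qed.

(** If all costs are at least [k.+1], summing over both directions gives
    [2 * #|V| * k.+1 <= \sum F + 2 * k * #|V|]. So [F], which never exceeds 2, has average at least
    2 and equals 2 everywhere. *)
Lemma start_cost_or_alternating (k : nat) :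
  (exists d u, (d = east \/ d = west) /\
     face_start d u + \sum_(i < k) face_weight d (u + (d, 1) *+ i.+1)%R <= k) \/
  forall u, face_start east u + face_start west (torus_step east true u) = 2.
Proof.
pose cost d u :=
  face_start d u + \sum_(i < k) face_weight d (u + (d, 1) *+ i.+1)%R.
have [/existsP[u le]|/existsPn gt1] := boolP [exists u, cost east u <= k].
  by left; exists east, u; split=> //; left.
have [/existsP[u le]|/existsPn gtN] := boolP [exists u, cost west u <= k].
  by left; exists west, u; split=> //; right.
right; pose F u := face_start east u + face_start west (torus_step east true u).
have sum_cost d : \sum_(u : V) cost d u =
    (\sum_(u : V) face_start d u + k * \sum_(u : V) face_weight d u)%N.
  rewrite big_split exchange_big /=; congr (_ + _)%N.
  under eq_bigr => i _ do rewrite (sum_translate (face_weight d)).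
  by rewrite sum_nat_const card_ord.
have le_cost d : (forall u, ~~ (cost d u <= k)) ->
    #|{: V}| * k.+1 <= \sum_(u : V) cost d u.
  by move=> gt; rewrite -sum_nat_const; apply: leq_sum => u _; rewrite ltnNge.
have := leq_add (le_cost _ gt1) (le_cost _ gtN).
have -> : (\sum_(u : V) cost east u + \sum_(u : V) cost west u)%N =
    (\sum_(u : V) F u + k * (#|{: V}| * 2))%N.
  rewrite !sum_cost -sum_face_weight mulnDr big_split.
  under [X in _ = (_ + X + _)%N]eq_bigr => u _ do rewrite torus_step1E.
  by rewrite (sum_translate (face_start west)) addnACA.
have leF u : F u <= 2 by rewrite /F /face_start; do 2![case: (_ && _)].
move=> leS u; apply/eqP; rewrite eqn_leq leF /= leqNgt; apply/negP=> ltF.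
have : \sum_(u : V) F u < #|{: V}| * 2.
  rewrite -sum_nat_const (bigD1 u) //= [X in _ < X](bigD1 u) //=.
  by rewrite -addSn leq_add //; apply: leq_sum => w _; apply: leF.
by move: leS; lia.
Qed.

(** The hypothesis makes the two edges at each corner of every square differ in color; opposite
    edges then agree, and both colors propagate along every step. *)
Lemma alternating_colors u s :
  (forall u,
     face_start east u + face_start west (torus_step east true u) = 2) ->
  colors east u s = [seq if t then xcolor east u else ycolor east u | t <- s].
Proof.
move=> alt.
have inv t w : xcolor east (torus_step east t w) = xcolor east w /\
    ycolor east (torus_step east t w) = ycolor east w.
  have altF v : [/\ xcolor east v != ycolor east v,
      xcolor east (torus_step east false v) = xcolor east v &
      ycolor east (torus_step east true v) = ycolor east v].
    have := alt v; rewrite /face_start torus_stepNK.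
    have -> : torus_step west false (torus_step east true v) =
              torus_step east true (torus_step east false v) by [].
    rewrite !xcolorN -![ycolor west _]/(ycolor east _).
    by move: (xcolor east v) (ycolor east v)
      (xcolor east (torus_step _ _ _)) (ycolor east (torus_step _ _ _))
      => [] [] [] [].
  have [ne xF yT] := altF w; have [ne' _ _] := altF (torus_step east t w).
  case: t ne' => ne'; rewrite ?xF ?yT; split=> //;
    move: ne ne'; rewrite ?xF ?yT.
    by case: (xcolor east w); case: (xcolor east _); case: (ycolor east w).
  by case: (ycolor east w); case: (ycolor east _); case: (xcolor east w).
elim: s u => //= t s IH u; congr (_ :: _); first by case: t.
rewrite -[LHS]/(colors east (torus_step east t u) s) IH.
by have [-> ->] := inv t u.
Qed.

Lemma few_changes (le_ab : a <= b) (b_gt1 : 1 < b) : 0 < a ->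
  exists u v, is_dist G u v (a + b) /\
    exists p, is_path G u v p /\ num_changes (edge_colors c u p) <= b - 1.
Proof.
move=> a_gt0.
suff [d [u [s [dE [sa sb] le]]]] : exists d u s,
    [/\ d = east \/ d = west, count id s = a /\ count negb s = b &
     num_changes (colors d u s) <= b - 1].
  have [dist_uv path_uv] := geodesic_walk u dE sa sb.
  by exists u, (u + (d *+ a, 1 *+ b))%R; split=> //; exists (walk d u s).
have [[d [u [dE le]]]|alt] := start_cost_or_alternating a.-1.
  (* After the first square, [a.-1] squares and [b - a] steps remain, and
     [a.-1 + (b - a) = b - 1]. *)
  have [s [s1 s2] les] := start_walk d u a.-1 (b - a).
  exists d, u, s; split=> //; first by rewrite s1 s2; lia.
  by apply: leq_trans les _; lia.
(* A walk with a single turn changes color at most once, and [1 <= b - 1]. *)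
exists east, 0%R, (nseq a true ++ nseq b false); split; first by left.
  by rewrite !count_cat !count_nseq /=; lia.
rewrite alternating_colors // map_cat !map_nseq.
rewrite -(prednK a_gt0) -(prednK (ltnW b_gt1)) /=.
set x := xcolor east 0%R; set y := ycolor east 0%R.
have nseq0 z k : count id (pairmap (fun c1 c2 => c1 != c2) z (nseq k z)) = 0.
  by elim: k => //= k ->; rewrite eqxx.
have last_nseq k : last x (nseq k x) = x by elim: k.
by rewrite pairmap_cat count_cat nseq0 /= last_nseq nseq0; case: (_ != _); lia.
Qed.

End Torus.

Theorem theorem5 (a b : nat) (ha : 1 <= a) (hab : a <= b) (hb : b <> 1)
    (c : {set ('I_(2 * a) * 'I_(2 * b))%type} -> bool) :
  let G := cartesian_rel (@cycle_rel (2 * a)) (@cycle_rel (2 * b)) in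
  exists u v : 'I_(2 * a) * 'I_(2 * b),
    is_dist G u v (a + b) /\
    exists p : seq ('I_(2 * a) * 'I_(2 * b)),
      is_path G u v p /\ num_changes (edge_colors c u p) <= b - 1.
Proof.
move=> G; rewrite {}/G.
(* The form [m.+2] gives the ordinals their ring structure. *)
have [m mE] : {m | m.+2 = 2 * a} by exists (2 * a).-2; lia.
have [n nE] : {n | n.+2 = 2 * b} by exists (2 * b).-2; lia.
have := few_changes mE nE; rewrite mE nE => few.
by apply: (few c) => //; lia.
Qed.
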